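(* The set $$\mathcal N^\dagger=\{L\in(0,\infty):\ \exists (a,b)\in\mathbb C^2 \text{ such that } a^2e^a=b^2e^b=(a+b)^2e^{-(a+b)}\ \text{and}\ L^2=-(a^2+ab+b^2)\}$$ is non-empty and countable. *)

(* Defs.v *)
From mathcomp Require Import all_boot all_order all_algebra.
From mathcomp Require Import complex.
From mathcomp Require Import all_classical all_reals all_analysis.

Set Implicit Arguments.
Unset Strict Implicit.
Unset Printing Implicit Defensive.

Import Order.TTheory GRing.Theory Num.Theory.

Local Open Scope classical_set_scope.
Local Open Scope ring_scope.
Local Open Scope complex_scope.

(* Not in the libraries: exp (x + i y) = e^x (cos y + i sin y) *)
Definition cexp (R : realType) (z : R[i]) : R[i] :=
  let: x +i* y := z in (expR x * cos y) +i* (expR x * sin y).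

Definition Ndagger (R : realType) : set R :=
  [set L : R | 0 < L /\
    exists a b : R[i],
      [/\ a ^+ 2 * cexp a = b ^+ 2 * cexp b,
          b ^+ 2 * cexp b = (a + b) ^+ 2 * cexp (- (a + b)) &
          L%:C ^+ 2 = - (a ^+ 2 + a * b + b ^+ 2)]].

Arguments Ndagger R : clear implicits.

(* Main.v *)
Require Import Defs.
From mathcomp Require Import all_boot all_order all_algebra.
From mathcomp Require Import complex.
From mathcomp Require Import all_classical all_reals all_analysis.
From mathcomp Require Import ring lra.

Set Implicit Arguments.
Unset Strict Implicit.
Unset Printing Implicit Defensive.

Import Order.TTheory GRing.Theory Num.Theory.
Import numFieldNormedType.Exports.

Local Open Scope classical_set_scope.
Local Open Scope ring_scope.
Local Open Scope complex_scope.

(** Put g(z) = z^2 e^z and c = -(a + b). The conditions say that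
g(a) = g(b) = g(c) with a + b + c = 0, and then L^2 = ab + bc + ca.

_Countability._ These are two holomorphic equations in (a, b), with Jacobian
determinant D = g'(a) g'(b) + g'(b) g'(c) + g'(c) g'(a).
A solution with D nonzero is isolated ([critical_isolated]), and a set of isolated points
of C^2 is countable ([countable_isolated]); since L is a function of (a, b), it
remains to see that D never vanishes when L > 0. Let s = L^2 and let m be the
common value of g. From z g'(z) = (z + 2) g(z) and a + b + c = 0,
  abc D = m^2 (3 abc + 4 s),
so D = 0 forces 3 abc = -4 s (the case m = 0 gives a = b = 0, hence L = 0).
Then a, b, c are the roots of the real cubic z^3 + s z + 4 s / 3. Its nonreal
roots have positive real part and its real root is negative, so that the
relation a + b + c = 0 requires roots of both kinds: a nonreal x + i y and the
real root -2x, where x > 0 and y^2 = 3 x^2 + s. But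
  |g(x + i y)| = (4 x^2 + s) e^x > 4 x^2 e^(-2 x) = |g(-2 x)|,
a contradiction ([critical_cubic_neq]).

_Existence._ Take the conjugate pair a, b = -t +- i t w with t, w > 0, so that
c = 2 t. Then g(a) and g(b) are conjugate, |g(a)| = g(c) amounts to
w^2 = 4 e^(3 t) - 1, and g(a) is a positive real as soon as a e^(i t w / 2) is
real, that is, w cos(t w / 2) = sin(t w / 2). With w the positive function of t
given by the modulus equation, the intermediate value theorem solves the phase
equation ([exists_conjugate_phase]), and
L^2 = t^2 (w^2 - 3) = 4 t^2 (e^(3 t) - 1) > 0. *)

(** * The l1 norm on the complex numbers *)

(** Being real-valued, this norm gives estimates that linear arithmetic over the
reals can handle, and it is directly comparable with approximation of each
coordinate by rationals. *)
Definition l1norm (R : realType) (z : R[i]) : R := `|complex.Re z| + `|complex.Im z|.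

Lemma l1norm_ge0 (R : realType) (z : R[i]) : 0 <= l1norm z.
Proof. by rewrite addr_ge0. Qed.

Lemma l1norm_eq0 (R : realType) (z : R[i]) : l1norm z <= 0 -> z = 0.
Proof.
case: z => x y; rewrite /l1norm /= => h.
have [x0 y0] : x = 0 /\ y = 0.
  by have := normr_ge0 x; have := normr_ge0 y => *; split; apply/eqP; rewrite -normr_le0; lra.
by rewrite x0 y0.
Qed.

Lemma l1normN (R : realType) (z : R[i]) : l1norm (- z) = l1norm z.
Proof. by case: z => x y; rewrite /l1norm /= !normrN. Qed.

Lemma l1normD (R : realType) (z w : R[i]) : l1norm (z + w) <= l1norm z + l1norm w.
Proof.
case: z w => [x y] [u v]; rewrite /l1norm /=.
have := ler_normD x u; have := ler_normD y v; lra.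
Qed.

Lemma l1normB (R : realType) (z w : R[i]) : l1norm (z - w) <= l1norm z + l1norm w.
Proof. by rewrite -(l1normN w) l1normD. Qed.

Lemma l1normM (R : realType) (z w : R[i]) : l1norm (z * w) <= l1norm z * l1norm w.
Proof.
case: z w => [x y] [u v]; rewrite /l1norm /=.
have := ler_normB (x * u) (y * v); have := ler_normD (x * v) (y * u).
rewrite !normrM; lra.
Qed.

(** * First-order expansions *)

Lemma is_derive_approx (R : realType) (f : R -> R) (a d e : R) :
  is_derive a 1 f d -> 0 < e ->
  exists2 r, 0 < r & forall h, `|h| < r -> `|f (a + h) - f a - d * h| <= e * `|h|.
Proof.
move=> [df <-] e0.
move/cvgrPdist_le : df => /(_ _ e0) /nbhs_ballP[r /= r0 H].
exists r => // h hr.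
have [->|h0] := eqVneq h 0; first by rewrite addr0 mulr0 subr0 subrr normr0 mulr0.
have := H h; rewrite /ball /= sub0r normrN => /(_ hr h0) /=.
rewrite /shift /GRing.scale /= mulr1 (addrC h) => {}H.
have -> : f (a + h) - f a - 'D_1 f a * h = - (('D_1 f a - h^-1 * (f (a + h) - f a)) * h).
  by field.
by rewrite normrN normrM ler_wpM2r.
Qed.

Lemma cexpD (R : realType) (z w : R[i]) : cexp (z + w) = cexp z * cexp w.
Proof.
case: z w => [x y] [u v] /=; rewrite expRD cosD sinD.
by apply/eqP; rewrite eq_complex /=; apply/andP; split; apply/eqP; ring.
Qed.

Lemma cexp0 (R : realType) : cexp (0 : R[i]) = 1.
Proof. by rewrite /cexp /= expR0 cos0 sin0 mulr0 mul1r. Qed.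

Lemma cexp_neq0 (R : realType) (z : R[i]) : cexp z != 0.
Proof.
apply/eqP => h; have := cexpD z (- z); rewrite subrr h mul0r cexp0.
by move/eqP; rewrite oner_eq0.
Qed.

(** The complex exponential has derivative 1 at 0. It suffices to expand e^x,
cos y and sin y to first order: the remaining terms are products of two small
quantities. *)
Lemma cexp_approx (R : realType) (e : R) : 0 < e ->
  exists2 r, 0 < r & forall h : R[i], l1norm h < r ->
    l1norm (cexp h - 1 - h) <= e * l1norm h.
Proof.
move=> e0; set d := Num.min (e / 8) (8^-1).
have d0 : 0 < d by rewrite lt_min divr_gt0 //= invr_gt0.
have [de d1] : d <= e / 8 /\ d <= 8^-1 by rewrite /d !ge_min !lexx orbT.
clearbody d.
have [r1 r10 H1] := is_derive_approx (is_derive_expR 0) d0.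
have [r2 r20 H2] := is_derive_approx (is_derive_cos 0) d0.
have [r3 r30 H3] := is_derive_approx (is_derive_sin 0) d0.
exists (Num.min d (Num.min r1 (Num.min r2 r3))); first by rewrite !lt_min d0 r10 r20 r30.
case=> x y; rewrite /l1norm /= !lt_min => /and4P[hd h1 h2 h3].
have x0 := normr_ge0 x; have y0 := normr_ge0 y.
have {}H1 : `|expR x - 1 - x| <= d * `|x|.
  by have := H1 x; rewrite add0r expR0 mul1r; apply; lra.
have {}H2 : `|cos y - 1| <= d * `|y|.
  by have := H2 y; rewrite add0r cos0 sin0 oppr0 mul0r subr0; apply; lra.
have {}H3 : `|sin y - y| <= d * `|y|.
  by have := H3 y; rewrite add0r cos0 sin0 subr0 mul1r; apply; lra.
(* In terms of the three remainders, both coordinates are sums of small terms. *)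
rewrite oppr0 addr0.
set X := expR x - 1 - x in H1; set C := cos y - 1 in H2; set S := sin y - y in H3.
have -> : expR x * cos y - 1 - x = X * C + X + C + x * C by rewrite /X /C; ring.
have -> : expR x * sin y - y = X * S + X * y + S + x * S + x * y by rewrite /X /S; ring.
have T1 : `|X * C + X + C + x * C| <= `|X| * `|C| + `|X| + `|C| + `|x| * `|C|.
  rewrite -!normrM; apply: le_trans (ler_normD _ _) _; rewrite lerD2r.
  by apply: le_trans (ler_normD _ _) _; rewrite lerD2r ler_normD.
have T2 : `|X * S + X * y + S + x * S + x * y| <=
    `|X| * `|S| + `|X| * `|y| + `|S| + `|x| * `|S| + `|x| * `|y|.
  rewrite -!normrM; apply: le_trans (ler_normD _ _) _; rewrite lerD2r.
  apply: le_trans (ler_normD _ _) _; rewrite lerD2r.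
  by apply: le_trans (ler_normD _ _) _; rewrite lerD2r ler_normD.
have X0 := normr_ge0 X; have C0 := normr_ge0 C; have S0 := normr_ge0 S.
set nx := `|x| in T1 T2 H1 H2 H3 hd x0 *; set ny := `|y| in T1 T2 H1 H2 H3 hd y0 *.
set nX := `|X| in T1 T2 H1 X0; set nC := `|C| in T1 H2 C0; set nS := `|S| in T2 H3 S0.
have nx1 : nx <= d by lra.
have ny1 : ny <= d by lra.
have bC : nC <= 1 by nra.
have bS : nS <= 1 by nra.
have U1 : nX * nC <= d * nx by nra.
have U2 : nx * nC <= d * nx by nra.
have U3 : nX * nS <= d * nx by nra.
have U4 : nX * ny <= d * nx by nra.
have U5 : nx * nS <= d * nx by nra.
have U6 : nx * ny <= d * nx by nra.
apply: (@le_trans _ _ (8 * d * (nx + ny))); last by rewrite ler_wpM2r ?addr_ge0//; lra.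
have := mulr_ge0 (ltW d0) y0; have := mulr_ge0 (ltW d0) x0; lra.
Qed.

Definition sqexp (R : realType) (z : R[i]) : R[i] := z ^+ 2 * cexp z.

Definition dsqexp (R : realType) (z : R[i]) : R[i] := (z ^+ 2 + 2 * z) * cexp z.

(** By the addition formula, the remainder is e^z times
(z + h)^2 (e^h - 1 - h) + (2 z + 1) h^2 + h^3, in which the first term is small
by the expansion of the exponential at 0 and the others are of second order. *)
Lemma sqexp_approx (R : realType) (z : R[i]) (e : R) : 0 < e ->
  exists2 r, 0 < r & forall h : R[i], l1norm h < r ->
    l1norm (sqexp (z + h) - sqexp z - dsqexp z * h) <= e * l1norm h.
Proof.
move=> e0; set Z := l1norm z; set E := l1norm (cexp z).
have Z0 : 0 <= Z by exact: l1norm_ge0.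
have E0 : 0 <= E by exact: l1norm_ge0.
pose e1 := e / (2 * ((E + 1) * (Z + 1) ^+ 2)).
pose e2 := e / (2 * ((E + 1) * (2 * Z + 2))).
have e10 : 0 < e1 by rewrite divr_gt0// !mulr_gt0// ?exprn_gt0//; lra.
have e20 : 0 < e2 by rewrite divr_gt0// !mulr_gt0//; lra.
have e1E : e1 * ((E + 1) * (Z + 1) ^+ 2) = e / 2.
  by rewrite /e1; field; apply/andP; split; apply: lt0r_neq0; lra.
have e2E : e2 * ((E + 1) * (2 * Z + 2)) = e / 2.
  by rewrite /e2; field; apply/andP; split; apply: lt0r_neq0; lra.
clearbody e1 e2.
have [r r0 Hr] := cexp_approx e10.
exists (Num.min 1 (Num.min r e2)); first by rewrite !lt_min ltr01 r0 e20.
move=> h; rewrite !lt_min => /and3P[h1 /Hr hr h2].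
set w := cexp h - 1 - h in hr.
have -> : sqexp (z + h) - sqexp z - dsqexp z * h =
    cexp z * ((z + h) * (z + h) * w + ((z + z + 1) * (h * h) + h * (h * h))).
  by rewrite /sqexp /dsqexp cexpD /w; ring.
set n := l1norm h in hr h1 h2 *.
have n0 : 0 <= n by exact: l1norm_ge0.
have T1 : l1norm ((z + h) * (z + h) * w) <= (Z + 1) ^+ 2 * (e1 * n).
  apply: le_trans (l1normM _ _) _; apply: ler_pM; rewrite ?l1norm_ge0//.
  apply: le_trans (l1normM _ _) _; rewrite expr2.
  have : l1norm (z + h) <= Z + 1 by apply: le_trans (l1normD _ _) _; rewrite lerD2l ltW.
  by move=> *; apply: ler_pM; rewrite ?l1norm_ge0.
have T0 : l1norm (h * h) <= n * n by exact: l1normM.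
have T2 : l1norm ((z + z + 1) * (h * h)) <= (2 * Z + 1) * (n * n).
  apply: le_trans (l1normM _ _) _; apply: ler_pM; rewrite ?l1norm_ge0//.
  apply: le_trans (l1normD _ _) _; apply: lerD.
    by apply: le_trans (l1normD _ _) _; rewrite mulr_natl mulr2n.
  by rewrite /l1norm /= normr0 normr1 addr0.
have T3 : l1norm (h * (h * h)) <= 1 * (n * n).
  apply: le_trans (l1normM _ _) _; apply: ler_pM; rewrite ?l1norm_ge0//.
  exact: ltW.
have T4 : l1norm ((z + h) * (z + h) * w + ((z + z + 1) * (h * h) + h * (h * h)))
    <= ((Z + 1) ^+ 2 * e1 + (2 * Z + 2) * e2) * n.
  apply: le_trans (l1normD _ _) _; rewrite [leRHS]mulrDl; apply: lerD; first by rewrite -[leRHS]mulrA.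
  apply: le_trans (l1normD _ _) _.
  apply: (@le_trans _ _ ((2 * Z + 2) * n * n)); first by lra.
  by rewrite -!mulrA ler_wpM2l ?ler_wpM2r ?(ltW h2)//; lra.
apply: le_trans (l1normM _ _) _.
apply: (@le_trans _ _ ((E + 1) * (((Z + 1) ^+ 2 * e1 + (2 * Z + 2) * e2) * n))).
  by apply: ler_pM; rewrite ?l1norm_ge0//; rewrite -/E; lra.
have -> : (E + 1) * (((Z + 1) ^+ 2 * e1 + (2 * Z + 2) * e2) * n) =
  (e1 * ((E + 1) * (Z + 1) ^+ 2) + e2 * ((E + 1) * (2 * Z + 2))) * n by ring.
by rewrite e1E e2E -splitr.
Qed.

(** * Isolated solutions *)

Definition critical (R : realType) (a b : R[i]) : Prop :=
  sqexp a = sqexp b /\ sqexp b = sqexp (- (a + b)).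

(** The Jacobian determinant of
(a, b) |-> (g(a) - g(b), g(b) - g(c)) for g(z) = z^2 e^z and c = -(a + b). *)
Definition critical_jacobian (R : realType) (a b : R[i]) : R[i] :=
  dsqexp a * dsqexp b + dsqexp b * dsqexp (- (a + b)) + dsqexp (- (a + b)) * dsqexp a.

(** Uniqueness part of the inverse function theorem. If (a + h, b + k) is another
solution, Cramer's rule expresses D h and D k through the first-order remainders
at a, b and c; close to (a, b) these are so small that
|h| + |k| <= (|h| + |k|) / 2. *)
Lemma critical_isolated (R : realType) (a b : R[i]) :
  critical a b -> critical_jacobian a b != 0 ->
  exists2 r, 0 < r & forall h k : R[i], critical (a + h) (b + k) ->
    l1norm h < r -> l1norm k < r -> h = 0 /\ k = 0.
Proof.
rewrite /critical_jacobian; set c := - (a + b); set D := (X in X != 0) => -[gab gbc] D0.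
set A := dsqexp a in D D0; set B := dsqexp b in D D0; set C := dsqexp c in D D0.
set I := l1norm D^-1; set S := l1norm A + l1norm B + l1norm C.
have I0 : 0 <= I by exact: l1norm_ge0.
have A0 := l1norm_ge0 A; have B0 := l1norm_ge0 B; have C0 := l1norm_ge0 C.
have S0 : 0 <= S by rewrite /S; lra.
(* The constant e makes each of |h| and |k| at most (|h| + |k|) / 4 in the end. *)
pose e := (8 * ((I + 1) * (S + 1)))^-1.
have e0 : 0 < e by rewrite invr_gt0 !mulr_gt0//; lra.
have eE : e * ((I + 1) * (S + 1)) = 8^-1.
  by rewrite /e; field; apply/andP; split; apply: lt0r_neq0; lra.
clearbody e.
have [r1 r10 H1] := sqexp_approx a e0.
have [r2 r20 H2] := sqexp_approx b e0.
have [r3 r30 H3] := sqexp_approx c e0.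
exists (Num.min r1 (Num.min r2 (r3 / 2))); first by rewrite !lt_min r10 r20 divr_gt0.
move=> h k [g1 g2]; rewrite !lt_min => /and3P[h1 _ h3] /and3P[_ k2 k3].
have hk : l1norm (- (h + k)) <= l1norm h + l1norm k by rewrite l1normN l1normD.
have {}H1 := H1 _ h1; have {}H2 := H2 _ k2.
have {}H3 := H3 (- (h + k)) ltac:(lra).
set wa := sqexp (a + h) - _ - _ in H1.
set wb := sqexp (b + k) - _ - _ in H2.
set wc := sqexp (c - _) - _ - _ in H3.
have cE : c - (h + k) = - (a + h + (b + k)) by rewrite /c; ring.
have E1 : A * h + wa = B * k + wb by rewrite /wa /wb g1 gab -/A -/B; ring.
have E2 : C * - (h + k) + wc = B * k + wb by rewrite /wc /wb cE -g2 -gbc -/C -/B; ring.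
set n := l1norm h + l1norm k in hk.
have h0 := l1norm_ge0 h; have k0 := l1norm_ge0 k.
have n0 : 0 <= n by rewrite addr_ge0.
have {}H1 : l1norm wa <= e * n.
  by apply: le_trans H1 _; rewrite ler_wpM2l ?(ltW e0)// /n; lra.
have {}H2 : l1norm wb <= e * n.
  by apply: le_trans H2 _; rewrite ler_wpM2l ?(ltW e0)// /n; lra.
have {}H3 : l1norm wc <= e * n.
  by apply: le_trans H3 _; rewrite ler_wpM2l ?(ltW e0).
have hE : h = D^-1 * (C * (wb - wa) + B * (wc - wa)).
  have -> : C * (wb - wa) + B * (wc - wa) =
    D * h + C * (B * k + wb - (A * h + wa)) + B * (B * k + wb - (A * h + wa))
    + B * (C * - (h + k) + wc - (B * k + wb)) by rewrite /D; ring.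
  by rewrite E1 E2 subrr !mulr0 !addr0 mulKf.
have kE : k = D^-1 * (C * (wa - wb) + A * (wc - wb)).
  have -> : C * (wa - wb) + A * (wc - wb) =
    D * k + C * ((A * h + wa) - (B * k + wb))
    + A * (C * - (h + k) + wc - (B * k + wb)) by rewrite /D; ring.
  by rewrite E1 E2 subrr !mulr0 !addr0 mulKf.
have bound (X Y u v w : R[i]) : l1norm u <= e * n -> l1norm v <= e * n ->
    l1norm w <= e * n -> l1norm X + l1norm Y <= S ->
    l1norm (D^-1 * (X * (u - v) + Y * (w - v))) <= n / 4.
  move=> Hu Hv Hw XY.
  have X0 := l1norm_ge0 X; have Y0 := l1norm_ge0 Y.
  have M1 : l1norm (X * (u - v)) <= l1norm X * (2 * (e * n)).
    apply: le_trans (l1normM _ _) _; rewrite ler_wpM2l//.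
    by apply: le_trans (l1normB _ _) _; lra.
  have M2 : l1norm (Y * (w - v)) <= l1norm Y * (2 * (e * n)).
    apply: le_trans (l1normM _ _) _; rewrite ler_wpM2l//.
    by apply: le_trans (l1normB _ _) _; lra.
  have en0 : 0 <= 2 * (e * n) by rewrite !mulr_ge0 // ltW.
  have M3 : l1norm (X * (u - v) + Y * (w - v)) <= (S + 1) * (2 * (e * n)).
    apply: le_trans (l1normD _ _) _.
    apply: (@le_trans _ _ ((l1norm X + l1norm Y) * (2 * (e * n)))); first by lra.
    by rewrite ler_wpM2r//; lra.
  apply: le_trans (l1normM _ _) _.
  apply: (@le_trans _ _ ((I + 1) * ((S + 1) * (2 * (e * n))))).
    by apply: ler_pM; rewrite ?l1norm_ge0//; rewrite -/I; lra.
  have -> : (I + 1) * ((S + 1) * (2 * (e * n))) = e * ((I + 1) * (S + 1)) * 2 * n by ring.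
  by rewrite eE; lra.
have b1 : l1norm h <= n / 4 by rewrite {1}hE bound// /S; lra.
have b2 : l1norm k <= n / 4 by rewrite {1}kE bound// /S; lra.
have n1 : n <= 0 by rewrite -[n]/(l1norm h + l1norm k) in b1 b2 *; lra.
by split; apply: l1norm_eq0; rewrite /n in n1; lra.
Qed.

(** * Nonvanishing of the Jacobian *)

(** For a nonreal root, the imaginary part of the equation gives
y^2 = 3 x^2 + s; substituted in the real part, it leaves an equation for x whose
left side is increasing and vanishes at 0. *)
Lemma depressed_cubic_root (R : realType) (s x y : R) : 0 < s ->
  3 * ((x +i* y) ^+ 3 + s%:C * (x +i* y)) + 4 * s%:C = 0 ->
  (y = 0 /\ x < 0) \/ [/\ 0 < x, y ^+ 2 = 3 * x ^+ 2 + s & 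
    3 * (8 * x ^+ 3 + 2 * s * x) = 4 * s].
Proof.
move=> s0 /eqP; rewrite eq_complex /= => /andP[/eqP re /eqP im].
have {}re : 3 * (x ^+ 3 - 3 * x * y ^+ 2 + s * x) + 4 * s = 0 by lra.
have {}im : y * (3 * x ^+ 2 - y ^+ 2 + s) = 0 by lra.
move/eqP : im; rewrite mulf_eq0 => /orP[/eqP y0|/eqP y2].
  left; split=> //; rewrite ltNge; apply/negP => x0.
  have := exprn_ge0 3 x0; have := mulr_ge0 (ltW s0) x0.
  by move: re; rewrite y0; lra.
have {}y2 : y ^+ 2 = 3 * x ^+ 2 + s by lra.
have E : 3 * (8 * x ^+ 3 + 2 * s * x) = 4 * s by move: re; rewrite y2; lra.
right; split=> //; rewrite ltNge; apply/negP => x0.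
have := sqr_ge0 x; nra.
Qed.

Definition sqmod (R : realType) (z : R[i]) : R :=
  complex.Re z ^+ 2 + complex.Im z ^+ 2.

Lemma sqmodM (R : realType) (z w : R[i]) : sqmod (z * w) = sqmod z * sqmod w.
Proof. by case: z w => [x y] [u v]; rewrite /sqmod /=; ring. Qed.

Lemma sqmod_sqexp (R : realType) (z : R[i]) :
  sqmod (sqexp z) = (sqmod z * expR (complex.Re z)) ^+ 2.
Proof.
rewrite /sqexp expr2 !sqmodM.
suff -> : sqmod (cexp z) = expR (complex.Re z) ^+ 2 by ring.
case: z => x y; rewrite /sqmod /= !exprMn -mulrDr.
by rewrite cos2Dsin2 mulr1.
Qed.

(** The equation satisfied by x says that -2x is a real root of the cubic, which
has only one; so r = -2x, and the moduli of the two values of z^2 e^z differ. *)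
Lemma mixed_roots_sqexp_neq (R : realType) (s x y r : R) : 0 < s ->
  0 < x -> y ^+ 2 = 3 * x ^+ 2 + s -> 3 * (8 * x ^+ 3 + 2 * s * x) = 4 * s ->
  r < 0 -> 3 * (r ^+ 3 + s * r) + 4 * s = 0 ->
  sqexp (x +i* y) <> sqexp r%:C.
Proof.
move=> s0 x0 y2 E r0 Er /(congr1 (@sqmod R)).
have rE : r = - 2 * x.
  have : (r + 2 * x) * (r ^+ 2 - 2 * x * r + 4 * x ^+ 2 + s) = 0 by lra.
  move/eqP; rewrite mulf_eq0 => /orP[/eqP|/eqP]; first by lra.
  by have := sqr_ge0 r; have := sqr_ge0 x; nra.
rewrite !sqmod_sqexp /sqmod /= => /eqP.
rewrite eqrXn2 ?mulr_ge0 ?addr_ge0 ?sqr_ge0 ?expR_ge0//; apply/negP.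
rewrite gt_eqF//; apply: (@lt_trans _ _ ((r ^+ 2 + 0 ^+ 2) * expR x)).
  have r2 : 0 < r ^+ 2 + 0 ^+ 2 by have := mulr_gt0 x0 x0; rewrite rE; nra.
  by rewrite ltr_pM2l// ltr_expR; lra.
by rewrite ltr_pM2r ?expR_gt0// y2 rE; lra.
Qed.

(** Otherwise a, b, c would be the roots of the real cubic z^3 + s z + 4 s / 3.
They are not all real, nor all nonreal, since their real parts sum to 0 while
the real roots are negative and the others have positive real part; a root of
each kind contradicts [mixed_roots_sqexp_neq]. *)
Lemma critical_cubic_neq (R : realType) (s : R) (a b c : R[i]) : 0 < s ->
  a + b + c = 0 -> s%:C = a * b + b * c + c * a ->
  sqexp a = sqexp b -> sqexp b = sqexp c -> 3 * (a * b * c) + 4 * s%:C != 0.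
Proof.
move=> s0 sum0 sE gab gbc; apply/eqP => D0.
have root z : (z - a) * (z - b) * (z - c) = 0 -> 3 * (z ^+ 3 + s%:C * z) + 4 * s%:C = 0.
  move=> z0; have -> : z ^+ 3 = (z - a) * (z - b) * (z - c) + (a + b + c) * z ^+ 2
     - (a * b + b * c + c * a) * z + a * b * c by ring.
  by rewrite z0 sum0 -sE -[RHS]D0; ring.
have Ra := root a ltac:(by rewrite subrr !mul0r).
have Rb := root b ltac:(by rewrite subrr mulr0 mul0r).
have Rc := root c ltac:(by rewrite subrr mulr0).
have gac : sqexp a = sqexp c by rewrite gab.
have real_root (r : R) : 3 * (r%:C ^+ 3 + s%:C * r%:C) + 4 * s%:C = 0 ->
    3 * (r ^+ 3 + s * r) + 4 * s = 0.
  by move/eqP; rewrite eq_complex /= => /andP[/eqP + _]; lra.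
have mixed (x y r : R) : 0 < x -> y ^+ 2 = 3 * x ^+ 2 + s ->
    3 * (8 * x ^+ 3 + 2 * s * x) = 4 * s -> r < 0 ->
    3 * (r%:C ^+ 3 + s%:C * r%:C) + 4 * s%:C = 0 -> sqexp (x +i* y) <> sqexp r%:C.
  by move=> x0 y2 E r0 /real_root; apply: mixed_roots_sqexp_neq.
clear root real_root D0 sE.
case: a b c sum0 Ra Rb Rc gab gbc gac => [xa ya] [xb yb] [xc yc] /eqP.
rewrite eq_complex /= => /andP[/eqP sum0 _] Ra Rb Rc gab gbc gac.
case: (depressed_cubic_root s0 Ra) => [[ya0 xa0]|[xa0 ya2 Ea]];
case: (depressed_cubic_root s0 Rb) => [[yb0 xb0]|[xb0 yb2 Eb]];
case: (depressed_cubic_root s0 Rc) => [[yc0 xc0]|[xc0 yc2 Ec]]; subst; try lra.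
- exact: (mixed _ _ _ xc0 yc2 Ec xa0 Ra (esym gac)).
- exact: (mixed _ _ _ xb0 yb2 Eb xa0 Ra (esym gab)).
- exact: (mixed _ _ _ xb0 yb2 Eb xa0 Ra (esym gab)).
- exact: (mixed _ _ _ xa0 ya2 Ea xb0 Rb gab).
- exact: (mixed _ _ _ xa0 ya2 Ea xb0 Rb gab).
- exact: (mixed _ _ _ xa0 ya2 Ea xc0 Rc gac).
Qed.

(** Multiplying the Jacobian by abc and using z g'(z) = (z + 2) g(z) turns it into
g(c)^2 (3 abc + 4 s). *)
Lemma critical_jacobian_neq0 (R : realType) (s : R) (a b : R[i]) : 0 < s ->
  s%:C = - (a ^+ 2 + a * b + b ^+ 2) -> critical a b -> critical_jacobian a b != 0.
Proof.
move=> s0 sE [gab gbc]; rewrite /critical_jacobian.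
set c := - (a + b) in gbc *.
have sum0 : a + b + c = 0 by rewrite /c subrr.
have e2E : s%:C = a * b + b * c + c * a by rewrite sE /c; ring.
have nz := critical_cubic_neq s0 sum0 e2E gab gbc.
have l0 : sqexp c != 0.
  apply/eqP => l0.
  have z0 (z : R[i]) : sqexp z = 0 -> z = 0.
    move/eqP; rewrite mulf_eq0 (negbTE (cexp_neq0 z)) orbF expf_eq0 /=.
    by move/eqP.
  have b0 := z0 b ltac:(by rewrite gbc).
  have a0 := z0 a ltac:(by rewrite gab gbc).
  move: sE; rewrite a0 b0 expr0n mulr0 !addr0 oppr0 => /eqP.
  by rewrite eq_complex /= gt_eqF.
apply: contraNneq (mulf_neq0 (expf_neq0 2 l0) nz) => D0; apply/eqP.
have dE (z : R[i]) : z * dsqexp z = (z + 2) * sqexp z.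
  by rewrite /dsqexp /sqexp; ring.
have : a * b * c * (dsqexp a * dsqexp b + dsqexp b * dsqexp c + dsqexp c * dsqexp a) = 0.
  by rewrite D0 mulr0.
have -> : a * b * c * (dsqexp a * dsqexp b + dsqexp b * dsqexp c + dsqexp c * dsqexp a) =
  (a * dsqexp a) * (b * dsqexp b) * c + (b * dsqexp b) * (c * dsqexp c) * a +
  (c * dsqexp c) * (a * dsqexp a) * b by ring.
rewrite !dE gab gbc => <-; rewrite e2E.
(* The two sides differ by a multiple of a + b + c. *)
have -> : sqexp c ^+ 2 * (3 * (a * b * c) + 4 * (a * b + b * c + c * a)) =
  sqexp c ^+ 2 * (3 * (a * b * c) + 4 * (a * b + b * c + c * a) + 4 * (a + b + c)).
  by rewrite sum0 mulr0 addr0.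
ring.
Qed.

(** * Countability *)

(** A point p isolated at scale 1/(n+1) is determined by n and by rational
coordinates close to those of p at that scale, so that countably many codes
suffice. *)
Lemma countable_isolated (R : realType) (A : set (R[i] * R[i])) :
  (forall p, A p -> exists2 r, 0 < r & forall q, A q ->
     l1norm (q.1 - p.1) < r -> l1norm (q.2 - p.2) < r -> q = p) ->
  countable A.
Proof.
move=> iso.
pose near (e : R) (z : R[i]) (u : rat * rat) :=
  `|complex.Re z - ratr u.1| < e / 4 /\ `|complex.Im z - ratr u.2| < e / 4.
have near_ex e z : 0 < e -> exists u, near e z u.
  move=> e0; have e4 : 0 < e / 4 by rewrite divr_gt0.
  have rat_near x : exists t : rat, `|x - ratr t| < e / 4.
    have [t] := @rat_in_itvoo R (x - e / 4) (x + e / 4) ltac:(lra).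
    by rewrite in_itv /= => /andP[? ?]; exists t; rewrite ltr_norml; lra.
  have [t1 ?] := rat_near (complex.Re z); have [t2 ?] := rat_near (complex.Im z).
  by exists (t1, t2).
have near_close e z w u : near e z u -> near e w u -> l1norm (w - z) < e.
  rewrite /near /l1norm !ltr_norml; case: z w => [x y] [x' y'] /=.
  move=> [/andP[? ?] /andP[? ?]] [/andP[? ?] /andP[? ?]].
  have : `|x' - x| < e / 2 by rewrite ltr_norml; lra.
  have : `|y' - y| < e / 2 by rewrite ltr_norml; lra.
  lra.
pose codes (p : R[i] * R[i]) (u : nat * ((rat * rat) * (rat * rat))) :=
  let e := u.1.+1%:R^-1 : R in
  [/\ near e p.1 u.2.1, near e p.2 u.2.2 & forall q, A q ->
     l1norm (q.1 - p.1) < e -> l1norm (q.2 - p.2) < e -> q = p].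
have [code codeP] : {code & forall p, A p -> codes p (code p)}.
  apply: (@choice _ _ (fun p u => A p -> codes p u)) => p.
  have [Ap|nAp] := pselect (A p); last by exists (0%N, ((0, 0), (0, 0))).
  have [r r0 Hr] := iso p Ap.
  have [n] := ltr_add_invr r0; rewrite add0r => nr.
  have n0 : 0 < n.+1%:R^-1 :> R by rewrite invr_gt0.
  have [u1 ?] := near_ex _ p.1 n0; have [u2 ?] := near_ex _ p.2 n0.
  exists (n, (u1, u2)) => _; split => // q Aq q1 q2.
  by apply: Hr => //; apply: lt_trans nr.
apply/countable_injP; exists (pickle \o code) => p q.
rewrite !inE => Ap Aq /(pcan_inj pickleK) E.
have [p1 p2 _] := codeP p Ap; have [q1 q2 Hq] := codeP q Aq.
by rewrite E in p1 p2; apply: Hq => //; apply: near_close; eassumption.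
Qed.

(** The set is the image of the isolated solutions under (a, b) |-> L. *)
Lemma Ndagger_countable (R : realType) : countable (Ndagger R).
Proof.
pose A := [set p : R[i] * R[i] | critical p.1 p.2 /\ critical_jacobian p.1 p.2 != 0].
have cA : countable A.
  apply: countable_isolated => -[a b] /= [cab Dab].
  have [r r0 Hr] := critical_isolated cab Dab.
  exists r => // -[a' b'] /= [cab' _] ha hb.
  have := Hr (a' - a) (b' - b); rewrite !subrKC => /(_ cab' ha hb).
  by case=> /subr0_eq -> /subr0_eq ->.
pose F (p : R[i] * R[i]) : R :=
  Num.sqrt (complex.Re (- (p.1 ^+ 2 + p.1 * p.2 + p.2 ^+ 2))).
apply: sub_countable cA; apply: card_le_trans (card_image_le F A).
apply: subset_card_le => L [L0 [a [b [gab gbc LE]]]].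
have cab : critical a b.
  by split=> //; rewrite /sqexp gbc sqrrN.
have L2E : (L ^+ 2)%:C = - (a ^+ 2 + a * b + b ^+ 2) by rewrite -LE rmorphXn.
exists (a, b).
  by split => //=; apply: (critical_jacobian_neq0 _ L2E) => //; rewrite exprn_gt0.
by rewrite /F /= -L2E /= sqrtr_sqr gtr0_norm.
Qed.

(** * Existence *)

(** Let w(t) be the positive solution of the modulus equation. As t w(t) runs
continuously from 0 to values above pi, choose t1 with t1 w(t1) = pi. The
function w cos(t w / 2) - sin(t w / 2) is positive at t = 0 and equals -1 at
t1, hence vanishes in between, and not at t = 0. *)
Lemma exists_conjugate_phase (R : realType) : exists t w : R,
  [/\ 0 < t, 0 < w, w ^+ 2 = 4 * expR (3 * t) - 1 &
    sin (t * w / 2) = w * cos (t * w / 2)].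
Proof.
pose w (t : R) := Num.sqrt (4 * expR (3 * t) - 1).
have w2 t : 0 <= t -> w t ^+ 2 = 4 * expR (3 * t) - 1.
  move=> t0; rewrite sqr_sqrtr//.
  have : 1 <= expR (3 * t) by rewrite -expR0 ler_expR mulr_ge0.
  lra.
have w1 t : 0 <= t -> 1 < w t.
  move=> t0; have : 1 <= expR (3 * t) by rewrite -expR0 ler_expR mulr_ge0.
  move=> e1; rewrite -sqrtr1 ltr_sqrt; lra.
have cw : continuous w.
  move=> t.
  apply: (@continuous_comp _ _ _ (fun t : R => 4 * expR (3 * t) - 1) Num.sqrt); last exact: sqrt_continuous.
  apply: (@continuousB _ _ _ (fun t : R => 4 * expR (3 * t)) (cst 1)); last exact: cst_continuous.
  apply: continuousM; first exact: cst_continuous.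
  apply: (@continuous_comp _ _ _ (fun t : R => 3 * t) expR); last exact: continuous_expR.
  by apply: continuousM; [exact: cst_continuous | exact].
have cy : continuous (fun t : R => t * w t / 2).
  move=> t; apply: (@continuousM _ _ (fun t : R => t * w t) (cst 2^-1)); last exact: cst_continuous.
  by apply: (@continuousM _ _ id w); [exact | exact: cw].
have pi0 := pi_gt0 R.
have [t1 t1I t1E] : exists2 t1, t1 \in `[0, pi] & t1 * w t1 / 2 = pi / 2.
  apply: IVT; first exact: ltW.
    exact: continuous_subspaceT.
  have := w1 _ (ltW pi0); rewrite !mul0r ge_min le_max => ?.
  by apply/andP; split; apply/orP; [left|right]; nra.
move: t1I; rewrite in_itv /= => /andP[t10 _].
pose H t := w t * cos (t * w t / 2) - sin (t * w t / 2).
have cH : continuous H.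
  move=> t.
  apply: (@continuousB _ _ _ (fun t : R => w t * cos (t * w t / 2)) (fun t : R => sin (t * w t / 2))).
    apply: (@continuousM _ _ w (fun t : R => cos (t * w t / 2))); first exact: cw.
    by apply: (@continuous_comp _ _ _ (fun t : R => t * w t / 2) cos); [exact: cy | exact: continuous_cos].
  by apply: (@continuous_comp _ _ _ (fun t : R => t * w t / 2) sin); [exact: cy | exact: continuous_sin].
have H0 : 0 < H 0.
  by rewrite /H !mul0r cos0 sin0 mulr1 subr0; have := w1 0 (lexx _); lra.
have [t] : exists2 t, t \in `[0, t1] & H t = 0.
  apply: IVT => //; first exact: continuous_subspaceT.
  have H1 : H t1 = -1 by rewrite /H t1E cos_pihalf sin_pihalf; ring.
  by rewrite H1 ge_min le_max (ltW H0) lerN10 orbT.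
rewrite in_itv /= => /andP[t0 _] Ht.
have tn0 : t != 0 by apply/eqP => E; move: H0 Ht; rewrite E => /gt_eqF/eqP.
exists t, (w t); split; [by rewrite lt_def tn0| | exact: w2 |].
  by have := w1 _ t0; lra.
by move: Ht; rewrite /H; lra.
Qed.

(** For h = t w / 2, the phase equation yields cos(h)^2 (1 + w^2) = 1, whence cos y
and sin y for y = t w = 2 h. They show that g(-t + i y) is real, and equal to
4 t^2 e^(2 t) = g(2 t). *)
Lemma Ndagger_nonempty (R : realType) : Ndagger R !=set0.
Proof.
have [t [w [t0 w0 w2 phase]]] := exists_conjugate_phase R.
set h := t * w / 2 in phase.
pose y := t * w; have yE : y = h *+ 2 by rewrite mulr2n /h -splitr.
have c2 : cos h ^+ 2 * (1 + w ^+ 2) = 1.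
  by rewrite -[RHS](cos2Dsin2 h) phase; ring.
have cosy : cos y = cos h ^+ 2 * (1 - w ^+ 2) by rewrite yE mulr2n cosD phase; ring.
have siny : sin y = cos h ^+ 2 * (2 * w) by rewrite yE mulr2n sinD phase; ring.
have re : (t ^+ 2 - y ^+ 2) * cos y + 2 * t * y * sin y = 4 * t ^+ 2 * expR (3 * t).
  rewrite cosy siny /y.
  have -> : 4 * t ^+ 2 * expR (3 * t) = t ^+ 2 * (1 + w ^+ 2) * (cos h ^+ 2 * (1 + w ^+ 2)).
    by rewrite c2 w2; ring.
  ring.
have im : (t ^+ 2 - y ^+ 2) * sin y - 2 * t * y * cos y = 0.
  by rewrite cosy siny /y; ring.
have e3 : expR (3 * t) * expR (- t) = expR (2 * t) by rewrite -expRD; congr expR; ring.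
have L2 : 0 < y ^+ 2 - 3 * t ^+ 2.
  have -> : y ^+ 2 - 3 * t ^+ 2 = 4 * t ^+ 2 * (expR (3 * t) - 1).
    by rewrite /y exprMn w2; ring.
  have e1 : 1 < expR (3 * t) by rewrite -[ltLHS]expR0 ltr_expR; lra.
  by rewrite !mulr_gt0 ?exprn_gt0// subr_gt0.
exists (Num.sqrt (y ^+ 2 - 3 * t ^+ 2)); split; first by rewrite sqrtr_gt0.
exists ((- t) +i* y), ((- t) +i* (- y)); split.
- apply/eqP; rewrite eq_complex /= cosN sinN; apply/andP; split; apply/eqP.
    by ring.
  apply: subr0_eq; rewrite -[RHS](mulr0 (2 * expR (- t))) -im; ring.
- have c2t : - (- t - t) = 2 * t by ring.
  apply/eqP; rewrite eq_complex /= c2t subrr oppr0 cosN sinN cos0 sin0.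
  apply/andP; split; apply/eqP.
    transitivity (expR (- t) * ((t ^+ 2 - y ^+ 2) * cos y + 2 * t * y * sin y)); first by ring.
    by rewrite re -e3; ring.
  transitivity (- expR (- t) * ((t ^+ 2 - y ^+ 2) * sin y - 2 * t * y * cos y)); first by ring.
  by rewrite im; ring.
- apply/eqP; rewrite eq_complex /=; apply/andP; split; apply/eqP; last by ring.
  by rewrite -expr2 sqr_sqrtr ?ltW//; ring.
Qed.

Theorem mainTheorem2 (R : realType) :
  Ndagger R !=set0 /\ countable (Ndagger R).
Proof. by split; [exact: Ndagger_nonempty | exact: Ndagger_countable]. Qed.
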